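(* Let $K$ be a Henselian rank one valued field of equicharacteristic zero, considered as a structure in the three-sorted language $\mathcal{L}^{P}$ of Denef--Pas. Let $A \subset K^{n}$ and let $f: A \to \mathbb{P}^{1}(K)$ be an $\mathcal{L}^{P}$-definable (with parameters) function. Then $f$ is piecewise continuous, i.e. there is a finite partition of $A$ into $\mathcal{L}^{P}$-definable subsets $A_{1},\ldots,A_{s}$, each locally closed in $K^{n}$, such that the restriction $f|_{A_{i}}$ is continuous for each $i=1,\ldots,s$.
   Context: A rank one valued field is a field with a valuation $v$ whose value group $\Gamma$ embeds into $(\mathbb{R},+)$ as an ordered group; equicharacteristic zero means $K$ and its residue field $\Bbbk$ both have characteristic $0$; Henselian means the valuation ring $R$ satisfies Hensel's lemma. The Denef--Pas language $\mathcal{L}^{P}$ has three sorts: the valued field $K$-sort (with the language of rings), the value group $\Gamma$-sort (with any augmentation of the language of ordered abelian groups with $\infty$), and the residue field $\Bbbk$-sort (with any augmentation of the language of rings). The only symbols connecting the sorts are the valuation map $v: K \to \Gamma \cup \{\infty\}$ and an angular component map $\overline{ac}: K \to \Bbbk$, which is multiplicative, sends $0$ to $0$, and coincides with the residue map on units of $R$. ''Definable'' means definable with parameters. $K^{n}$ carries the product topology of the valuation topology on $K$ (the $K$-topology), and $\mathbb{P}^{1}(K)$ (the projective line over $K$) carries the topology induced by the valuation topology via its standard affine charts; a subset is locally closed if it is the intersection of an open set and a closed set. *)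

(* Defs.v *)
From HB Require Import structures.
From mathcomp Require Import all_boot all_order all_algebra.
From mathcomp Require Import reals constructive_ereal.
Set Implicit Arguments. Unset Strict Implicit. Unset Printing Implicit Defensive.
Import Order.TTheory GRing.Theory Num.Theory.
Local Open Scope ring_scope.
Local Open Scope ereal_scope.

(* Rank one valued fields: the valuation takes values in \bar R,       *)
(* with v x = +oo iff x = 0 (so the value group Gamma = v(K^x) is a    *)
(* subgroup of (R,+), and the Gamma-sort Gamma u {oo} is v(K)).        *)

Definition is_valuation (K : fieldType) (R : realType) (v : K -> \bar R) : Prop :=
  [/\ forall x, v x = +oo <-> x = 0%R,
      forall x, v x != -oo,
      forall x y, v (x * y)%R = v x + v y &
      forall x y, Order.min (v x) (v y) <= v (x + y)%R].

(* rank one = the value group is a nontrivial subgroup of R *)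
Definition nontrivial_valuation (K : fieldType) (R : realType) (v : K -> \bar R) : Prop :=
  exists x : K, x != 0%R /\ v x != 0.

Definition henselian (K : fieldType) (R : realType) (v : K -> \bar R) : Prop :=
  forall (p : {poly K}) (a : K),
    p \is monic -> (forall i, 0 <= v p`_i) ->
    0 <= v a -> 0 < v p.[a] -> v (p^`()).[a] = 0 ->
    exists b : K, p.[b] = 0%R /\ 0 < v (b - a)%R.

(* res : O -> k is a surjective ring morphism with kernel the maximal ideal;
   i.e. k is (isomorphic to) the residue field O/m.  Values of res outside O
   are irrelevant. *)
Definition residue_map (K k : fieldType) (R : realType) (v : K -> \bar R)
    (res : K -> k) : Prop :=
  [/\ forall x y, 0 <= v x -> 0 <= v y -> res (x + y)%R = (res x + res y)%R,
      forall x y, 0 <= v x -> 0 <= v y -> res (x * y)%R = (res x * res y)%R,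
      res 1%R = 1%R,
      forall x, 0 <= v x -> (res x = 0%R <-> 0 < v x) &
      forall r : k, exists x, 0 <= v x /\ res x = r].

Definition angular_component (K k : fieldType) (R : realType) (v : K -> \bar R)
    (res : K -> k) (ac : K -> k) : Prop :=
  [/\ forall x y, ac (x * y)%R = (ac x * ac y)%R,
      ac 0%R = 0%R &
      forall x, v x = 0 -> ac x = res x].

(* The Denef--Pas language L^P with an arbitrary augmentation of the   *)
(* Gamma-sort and k-sort languages by function and relation symbols.   *)

Record augmentation := Augmentation {
  gfun_sym : Type; gfun_ar : gfun_sym -> nat;
  grel_sym : Type; grel_ar : grel_sym -> nat;
  kfun_sym : Type; kfun_ar : kfun_sym -> nat;
  krel_sym : Type; krel_ar : krel_sym -> nat }.

(* interpretation of the extra symbols; Gamma-sort symbols are given on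
   \bar R, and are required (in the theorem) to preserve the Gamma-sort
   v(K) = Gamma u {oo} *)
Record aug_interp (L : augmentation) (R : realType) (k : Type) := AugInterp {
  gfun_i : forall s : gfun_sym L, ('I_(gfun_ar s) -> \bar R) -> \bar R;
  grel_i : forall s : grel_sym L, ('I_(grel_ar s) -> \bar R) -> Prop;
  kfun_i : forall s : kfun_sym L, ('I_(kfun_ar s) -> k) -> k;
  krel_i : forall s : krel_sym L, ('I_(krel_ar s) -> k) -> Prop }.
Arguments gfun_i {L R k} a s _.
Arguments grel_i {L R k} a s _.
Arguments kfun_i {L R k} a s _.
Arguments krel_i {L R k} a s _.

Definition aug_interp_ok (L : augmentation) (R : realType) (k K : Type)
    (v : K -> \bar R) (I : aug_interp L R k) : Prop :=
  forall (s : gfun_sym L) (a : 'I_(gfun_ar s) -> \bar R),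
    (forall j, exists x, v x = a j) -> exists x, v x = gfun_i I s a.

Inductive tK (K : Type) : Type :=
  | KVar of nat | KConst of K | KZero | KOne
  | KAdd of tK K & tK K | KOpp of tK K | KMul of tK K & tK K.

(* Gamma-sort terms. Parameters from Gamma u {oo} = v(K) are available as
   GVal (KConst c). *)
Inductive tG (K : Type) (L : augmentation) : Type :=
  | GVar of nat | GVal of tK K | GZero | GInf
  | GAdd of tG K L & tG K L
  | GFun (s : gfun_sym L) of ('I_(gfun_ar s) -> tG K L).

Inductive tk (K k : Type) (L : augmentation) : Type :=
  | kVar of nat | kConst of k | kAc of tK K | kZero | kOne
  | kAdd of tk K k L & tk K k L | kOpp of tk K k L | kMul of tk K k L & tk K k L
  | kFun (s : kfun_sym L) of ('I_(kfun_ar s) -> tk K k L).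

Inductive form (K k : Type) (L : augmentation) : Type :=
  | FKeq of tK K & tK K
  | FGeq of tG K L & tG K L
  | FGlt of tG K L & tG K L
  | Fkeq of tk K k L & tk K k L
  | FGrel (s : grel_sym L) of ('I_(grel_ar s) -> tG K L)
  | Fkrel (s : krel_sym L) of ('I_(krel_ar s) -> tk K k L)
  | FNot of form K k L
  | FAnd of form K k L & form K k L
  | FExK of nat & form K k L
  | FExG of nat & form K k L
  | FExk of nat & form K k L.

Definition upd (T : Type) (e : nat -> T) (i : nat) (a : T) : nat -> T :=
  fun j => if j == i then a else e j.

Section Semantics.
Variables (K k : fieldType) (R : realType) (L : augmentation).
Variables (v : K -> \bar R) (ac : K -> k) (I : aug_interp L R k).

Fixpoint evK (e : nat -> K) (t : tK K) : K :=
  match t with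
  | KVar i => e i | KConst c => c | KZero => 0%R | KOne => 1%R
  | KAdd t u => (evK e t + evK e u)%R | KOpp t => (- evK e t)%R
  | KMul t u => (evK e t * evK e u)%R
  end.

Fixpoint evG (e : nat -> K) (eg : nat -> \bar R) (t : tG K L) : \bar R :=
  match t with
  | GVar i => eg i | GVal u => v (evK e u) | GZero => 0 | GInf => +oo
  | GAdd a b => evG e eg a + evG e eg b
  | GFun s args => gfun_i I s (fun j => evG e eg (args j))
  end.

Fixpoint evk (e : nat -> K) (ek : nat -> k) (t : tk K k L) : k :=
  match t with
  | kVar i => ek i | kConst c => c | kAc u => ac (evK e u)
  | kZero => 0%R | kOne => 1%R
  | kAdd a b => (evk e ek a + evk e ek b)%R | kOpp a => (- evk e ek a)%R
  | kMul a b => (evk e ek a * evk e ek b)%R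
  | kFun s args => kfun_i I s (fun j => evk e ek (args j))
  end.

(* satisfaction; Gamma-sort quantifiers range over Gamma u {oo} = v(K) *)
Fixpoint sat (e : nat -> K) (eg : nat -> \bar R) (ek : nat -> k)
    (phi : form K k L) : Prop :=
  match phi with
  | FKeq t u => evK e t = evK e u
  | FGeq a b => evG e eg a = evG e eg b
  | FGlt a b => evG e eg a < evG e eg b
  | Fkeq a b => evk e ek a = evk e ek b
  | FGrel s args => grel_i I s (fun j => evG e eg (args j))
  | Fkrel s args => krel_i I s (fun j => evk e ek (args j))
  | FNot p => ~ sat e eg ek p
  | FAnd p q => sat e eg ek p /\ sat e eg ek q
  | FExK i p => exists x : K, sat (upd e i x) eg ek p
  | FExG i p => exists x : K, sat e (upd eg i (v x)) ek p
  | FExk i p => exists r : k, sat e eg (upd ek i r) p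
  end.

Definition envK (m : nat) (x : 'I_m -> K) : nat -> K :=
  fun i => match ltnP i m with
           | LtnNotGeq h => x (Ordinal h)
           | _ => 0%R
           end.

Definition definable (m : nat) (A : ('I_m -> K) -> Prop) : Prop :=
  exists phi : form K k L,
    forall x, A x <-> sat (envK x) (fun _ => v 0%R) (fun _ => 0%R) phi.

(* P^1(K) = K u {oo} as option K (None = oo); the point with homogeneous *)
(* coordinates (a:b), (a,b) <> (0,0).                                  *)
Definition P1_of (a b : K) : option K :=
  if b == 0%R then None else Some (a / b)%R.

(* f : A -> P^1(K) is definable iff its graph, via homogeneous
   coordinates, is a definable subset of K^(n+2) *)
Definition definable_fun (n : nat) (A : ('I_n -> K) -> Prop)
    (f : ('I_n -> K) -> option K) : Prop :=
  definable (fun z : 'I_(n.+2) -> K =>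
    let x := fun i : 'I_n => z (inord i) in
    let a := z (inord n) in let b := z (inord n.+1) in
    [/\ A x, (a != 0%R) || (b != 0%R) & f x = P1_of a b]).

Definition vball (m : nat) (x : 'I_m -> K) (g : R) (y : 'I_m -> K) : Prop :=
  forall i, g%:E < v (y i - x i)%R.

Definition openKn (m : nat) (U : ('I_m -> K) -> Prop) : Prop :=
  forall x, U x -> exists g : R, forall y, vball x g y -> U y.

Definition openK (U : K -> Prop) : Prop :=
  forall x, U x -> exists g : R, forall y, g%:E < v (y - x)%R -> U y.

(* topology of P^1(K) induced through the two standard affine charts *)
Definition openP1 (V : option K -> Prop) : Prop :=
  openK (fun y => V (Some y)) /\
  openK (fun y => V (if y == 0%R then None else Some y^-1)%R).

Definition locally_closed (m : nat) (B : ('I_m -> K) -> Prop) : Prop :=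
  exists U C : ('I_m -> K) -> Prop,
    [/\ openKn U, openKn (fun x => ~ C x) & forall x, B x <-> U x /\ C x].

Definition continuous_on (n : nat) (B : ('I_n -> K) -> Prop)
    (f : ('I_n -> K) -> option K) : Prop :=
  forall x, B x -> forall V, openP1 V -> V (f x) ->
    exists g : R, forall y, B y -> vball x g y -> V (f y).

End Semantics.

(* Main.v *)
Require Import Defs.
From HB Require Import structures.
From mathcomp Require Import all_boot all_order all_algebra.
From mathcomp Require Import reals constructive_ereal.
From mathcomp Require Import boolp functions zify ring lra.
Set Implicit Arguments. Unset Strict Implicit. Unset Printing Implicit Defensive.
Import Order.TTheory GRing.Theory Num.Theory.
Local Open Scope ring_scope.

(** Call two elements of K rv-equivalent if they have the same class in
    K^x / (1 + m), or are both zero. Key fact: for finitely many polynomials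
    p(x, Y) there are finitely many polynomials q(x) such that, if x and x' give
    rv-equivalent values to every q, then each y has a y' with all p(x, y),
    p(x', y') rv-equivalent. To see it, expand the p at a centre b closest to y
    among 0 and the roots of the derivatives of the p: by Hensel's lemma no
    cancellation occurs in the Taylor sums at y, so rv p(x, y) is determined by
    rv (y - b) and the rv of the Taylor coefficients. It remains to transfer b, a
    root of lower complexity, which is done by induction on the degree, again
    with a best centre and one use of Hensel's lemma. Hence the truth of any
    formula only depends on the rv-classes of finitely many polynomials, whatever
    the structure on the other two sorts. Applied to the graph of f, with an
    auxiliary generic parameter w near y and the polynomial Y - w, the key fact
    moves the point f(x) to a nearby f(x') when x' is close to x and lies in the
    same stratum, the strata being given by the vanishing or not of finitely many
    polynomials in x. *)

(** * Valuation arithmetic and rv-equivalence *)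

Section Valuation.
Variables (K : fieldType) (R : realType) (v : K -> \bar R).
Hypothesis hv : is_valuation v.

Lemma val0 : v 0 = +oo%E.
Proof. by case: hv => h _ _ _; apply/h. Qed.

Lemma valM x y : v (x * y) = (v x + v y)%E.
Proof. by case: hv. Qed.

Lemma val_pinfty x : (v x == +oo%E) = (x == 0).
Proof. by case: hv => h _ _ _; apply/eqP/eqP=> /h. Qed.

Lemma val_fin x : x != 0 -> v x \is a fin_num.
Proof. by case: hv => _ h _ _; rewrite fin_numE h val_pinfty. Qed.

Lemma val_lt_pinfty x : (v x < +oo)%E = (x != 0).
Proof. by rewrite ltey val_pinfty. Qed.

Lemma val1 : v 1 = 0%E.
Proof.
have := valM 1 1; have := val_fin (oner_neq0 K); rewrite mul1r.
by case: (v 1) => // r _ [rE]; congr EFin; lra.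
Qed.

Lemma ltr_valM c x y : c != 0 -> (v (c * x) < v (c * y))%E = (v x < v y)%E.
Proof. by move=> /val_fin c0; rewrite !valM lteD2lE. Qed.

Lemma ler_valM c x y : c != 0 -> (v (c * x) <= v (c * y))%E = (v x <= v y)%E.
Proof. by move=> /val_fin c0; rewrite !valM leeD2lE. Qed.

Lemma valN x : v (- x) = v x.
Proof.
suff h : v (-1) = 0%E by rewrite -mulN1r valM h add0e.
have := valM (-1) (-1); rewrite mulrNN mulr1 val1.
have: v (-1) \is a fin_num by apply: val_fin; rewrite oppr_eq0 oner_neq0.
by case: (v (-1)) => // r _ [rE]; congr EFin; lra.
Qed.

Lemma valB x y : v (x - y) = v (y - x).
Proof. by rewrite -valN opprB. Qed.

Lemma valD_ge g x y : (g <= v x)%E -> (g <= v y)%E -> (g <= v (x + y))%E.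
Proof.
move=> gx gy; case: hv => _ _ _ /(_ x y); apply: le_trans.
by rewrite le_min gx gy.
Qed.

Lemma valD_gt g x y : (g < v x)%E -> (g < v y)%E -> (g < v (x + y))%E.
Proof.
move=> gx gy; case: hv => _ _ _ /(_ x y); apply: lt_le_trans.
by rewrite lt_min gx gy.
Qed.

Lemma val_sum_ge g (I : Type) (r : seq I) (P : pred I) (F : I -> K) :
  (forall i, P i -> (g <= v (F i))%E) -> (g <= v (\sum_(i <- r | P i) F i))%E.
Proof.
by move=> h; elim/big_ind: _ => //; [rewrite val0 leey|exact: valD_ge].
Qed.

Lemma val_sum_gt g (I : Type) (r : seq I) (P : pred I) (F : I -> K) :
  (g < +oo)%E ->
  (forall i, P i -> (g < v (F i))%E) -> (g < v (\sum_(i <- r | P i) F i))%E.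
Proof.
by move=> g0 h; elim/big_ind: _ => //; [rewrite val0|exact: valD_gt].
Qed.

Lemma val_unitX x n : v x = 0%E -> v (x ^+ n) = 0%E.
Proof. by move=> x0; elim: n => [|n IH]; rewrite ?val1 // exprS valM x0 IH adde0. Qed.

(** Isosceles principle: a larger valuation of [y] would force [x = (x - y) + y] to have valuation
    above [v x]. *)
Lemma val_ltB x y : (v x < v (x - y))%E -> v y = v x.
Proof.
move=> h; apply/eqP; rewrite eq_le; apply/andP; split; last first.
  by rewrite -[y](subKr x); apply: valD_ge; rewrite ?valN // ltW.
rewrite leNgt; apply/negP=> hy; have: (v x < v (x - y + y))%E by apply: valD_gt.
by rewrite subrK ltxx.
Qed.

(* For nonzero a, b this is equality of classes in K^x / (1 + m), which
   amounts to v a = v b and ac a = ac b. *)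
Definition rveq (a b : K) : Prop := a = b \/ (v a < v (a - b))%E.

Lemma rveq_val a b : rveq a b -> v a = v b.
Proof. by case=> [->//|/val_ltB]. Qed.

Lemma rveq_refl a : rveq a a.
Proof. by left. Qed.

Lemma rveq_sym a b : rveq a b -> rveq b a.
Proof.
move=> h; case: (h) => [->|hab]; [by left|right].
by rewrite -(rveq_val h) valB.
Qed.

Lemma rveq_trans a b c : rveq a b -> rveq b c -> rveq a c.
Proof.
move=> hab; case: (hab) => [->//|ab] [<-//|bc]; right.
by rewrite -(subrKA b); apply: valD_gt; rewrite // (rveq_val hab).
Qed.

Lemma rveq_eq0 a b : rveq a b -> (a == 0) = (b == 0).
Proof. by move=> h; rewrite -!val_pinfty (rveq_val h). Qed.

Lemma rveq0 a b : rveq a b -> a = 0 -> b = 0.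
Proof. by move=> h /eqP; rewrite (rveq_eq0 h) => /eqP. Qed.

Lemma rveqMl c a b : rveq a b -> rveq (c * a) (c * b).
Proof.
case=> [->|h]; first by left.
have [->|c0] := eqVneq c 0; first by rewrite !mul0r; left.
by right; rewrite -mulrBr ltr_valM.
Qed.

Lemma rveqM a b c d : rveq a b -> rveq c d -> rveq (a * c) (b * d).
Proof.
move=> ab cd; apply: rveq_trans (rveqMl _ cd) _.
by rewrite -![_ * d]mulrC; apply: rveqMl.
Qed.

Lemma rveqX a b n : rveq a b -> rveq (a ^+ n) (b ^+ n).
Proof.
move=> ab; elim: n => [|n IH]; first exact: rveq_refl.
by rewrite !exprS; apply: rveqM.
Qed.

Lemma rveqV a b : rveq a b -> rveq a^-1 b^-1.
Proof.
move=> h; have [a0|a0] := eqVneq a 0; first by rewrite a0 (rveq0 h a0); left.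
have b0 : b != 0 by rewrite -(rveq_eq0 h).
case: (h) => [->|ab]; [by left|right].
rewrite -(@ltr_valM (a * b)) ?mulf_neq0 //.
rewrite mulrBr mulrAC mulfV // mul1r mulfK // valB.
by rewrite -(rveq_val h).
Qed.

Lemma rveq_cancel c d a b : c != 0 ->
  rveq c d -> rveq (c * a) (d * b) -> rveq a b.
Proof.
move=> c0 cd /(rveqM (rveqV cd)); rewrite !mulKf //.
by rewrite -(rveq_eq0 cd).
Qed.

(** The second hypothesis excludes cancellation: each error [a i - b i] has valuation above that of
    its term, hence above that of the whole sum. If the sum is 0, all terms are 0. *)
Lemma rveq_sum n (a b : 'I_n -> K) :
  (forall i, rveq (a i) (b i)) ->
  (forall i, v (\sum_i a i) <= v (a i))%E -> rveq (\sum_i a i) (\sum_i b i).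
Proof.
move=> ab hle; have [s0|s0] := eqVneq (\sum_i a i) 0.
  left; apply: eq_bigr => i _; case: (ab i) => // /(le_lt_trans (hle i)).
  by rewrite s0 val0 ltNge leey.
right; rewrite -sumrB; apply: val_sum_gt => [|i _].
  by rewrite val_lt_pinfty.
case: (ab i) => [->|h]; last exact: le_lt_trans (hle i) h.
by rewrite subrr val0 val_lt_pinfty.
Qed.

(** * Hensel's lemma without monicity *)

Lemma val_horner_gt (p : {poly K}) x :
  (forall i, 0 < v p`_i)%E -> (0 <= v x)%E -> (0 < v p.[x])%E.
Proof.
move=> hp hx; rewrite horner_coef; apply: val_sum_gt => [|i _]; first exact: ltry.
rewrite valM; apply: lt_le_trans (hp i) _; rewrite leeDl //.
elim: (nat_of_ord i) => [|n IH]; first by rewrite expr0 val1.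
by rewrite exprS valM adde_ge0.
Qed.

Lemma val_div x y : y != 0 -> (0 <= v (x / y))%E = (v y <= v x)%E.
Proof. by move=> y0; rewrite -val1 -(ler_valM _ _ y0) mulr1 mulrC divfK. Qed.

Lemma val_div_gt x y : y != 0 -> (0 < v (x / y))%E = (v y < v x)%E.
Proof. by move=> y0; rewrite -val1 -(ltr_valM _ _ y0) mulr1 mulrC divfK. Qed.

Hypothesis hhens : henselian v.

Lemma val_bool_ge0 (b : bool) : (0 <= v b%:R)%E.
Proof. by case: b; rewrite ?val1 ?val0 // leey. Qed.

Lemma valMn_gt g x n : (g < +oo)%E -> (g < v x)%E -> (g < v (x *+ n))%E.
Proof.
move=> g0 h; elim: n => [|n IH]; first by rewrite mulr0n val0.
by rewrite mulrS; apply: valD_gt.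
Qed.

Lemma valD_eq0 x e : v x = 0%E -> (0 < v e)%E -> v (x + e) = 0%E.
Proof. by move=> x0 e0; rewrite -x0; apply: val_ltB; rewrite x0 opprD addNKr valN. Qed.

(* The hypothesis [henselian] only concerns monic polynomials: with
   p = a0 + a1 X + ..., the substitution X = a0 / (a1 W) turns p into
   W^N + W^(N-1) + (terms with coefficients in m), up to a factor. *)
Lemma hensel_at0 (p : {poly K}) : (forall i, 0 <= v p`_i)%E ->
  (0 < v p`_0)%E -> v p`_1 = 0%E -> exists t, p.[t] = 0 /\ (0 < v t)%E.
Proof.
move=> hp h0 h1; set a0 := p`_0 in h0; set a1 := p`_1 in h1.
have [a00|a00] := eqVneq a0 0.
  by exists 0; rewrite horner_coef0 -/a0 a00 val0 ltry.
have a10 : a1 != 0 by rewrite -(val_pinfty) h1.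
have vV x : v x = 0%E -> v x^-1 = 0%E.
  move=> x0; have xn0 : x != 0 by rewrite -val_pinfty x0.
  by have := valM x x^-1; rewrite mulfV // val1 x0 add0e.
set N := size p.
have N0 : (0 < N)%N.
  by rewrite lt0n; apply: contraNneq a10 => /eqP; rewrite size_poly_eq0 /a1 => /eqP->; rewrite coef0.
(* These coefficients remain after dividing the value of [p] at [a0 / (a1 * W)] by [a0 / W ^+ N.+1].
   The power of [a0] puts them in the maximal ideal. *)
pose c i := p`_i.+2 * a0 ^+ i.+1 / a1 ^+ i.+2.
have hc i : (0 < v (c i))%E.
  have v1 : v (a1 ^+ i.+2)^-1 = 0%E by apply: vV; apply: val_unitX.
  rewrite !valM v1 adde0.
  apply: (@lt_le_trans _ _ (v (a0 ^+ i.+1))); last by rewrite leeDr.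
  elim: i {v1} => [|i IH]; first by rewrite expr1.
  by rewrite exprS valM; apply: lt_le_trans IH _; rewrite leeDr // ltW.
pose r := \sum_(i < N) (c i)%:P * 'X^(N.-1 - i).
have hr j : (0 < v r`_j)%E.
  rewrite coef_sum; apply: val_sum_gt => [|i _]; first exact: ltry.
  rewrite coefCM coefXn; case: (_ == _); rewrite ?mulr1 ?mulr0 //.
  by rewrite val0 ltry.
pose q := 'X^N * ('X + 1) + r.
have szr : (size r <= N)%N.
  apply: (leq_trans (size_sum _ _ _)); apply/bigmax_leqP => i _.
  apply: (leq_trans (size_polyMleq _ _)); rewrite size_polyXn size_polyC.
  by case: (_ != _) => //=; rewrite ?add0n //; have := ltn_ord i; lia.
have mon1 : ('X + 1 : {poly K}) \is monic by rewrite -polyC1 -[1%:P]opprK -polyCN monicXsubC.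
have qmon : q \is monic.
  have XN0 : 'X^N != 0 :> {poly K} by rewrite monic_neq0 ?monicXn.
  rewrite monicE lead_coefDl; first by rewrite -monicE monicMl ?monicXn.
  by rewrite (size_Mmonic XN0 mon1) size_polyXn -polyC1 size_XaddC addn2 ltnS (leq_trans szr).
have qint i : (0 <= v q`_i)%E.
  rewrite coefD; apply: valD_ge; last exact: ltW.
  rewrite coefXnM; case: ltnP => _; first by rewrite val0 leey.
  by rewrite coefD coefX coef1; apply: valD_ge; apply: val_bool_ge0.
have vN1 : v (-1) = 0%E by rewrite valN val1.
have vN1' : (0 <= v (-1))%E by rewrite vN1.
(* Modulo the maximal ideal [q] is ['X^N * ('X + 1)], which has the simple root -1. *)
have q1 : (0 < v q.[-1])%E.
  by rewrite !hornerE addNr mulr0 add0r val_horner_gt.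
have q'1 : v (q^`()).[-1] = 0%E.
  rewrite derivD derivM derivD derivX derivC addr0 !hornerE addNr mulr0 add0r ?mulr1.
  apply: valD_eq0; first exact: val_unitX.
  apply: val_horner_gt => // i; rewrite coef_deriv.
  by apply: valMn_gt; rewrite ?ltry.
have [W [qW hW]] := hhens qmon qint vN1' q1 q'1.
have vW : v W = 0%E by rewrite -[W](addrNK (-1)) addrC valD_eq0.
have W0 : W != 0 by rewrite -val_pinfty vW.
exists (a0 / (a1 * W)); split; last by rewrite valM vV ?adde0 // valM h1 vW adde0.
(* Padding to [N.+2] terms leaves, after [a0] and the linear term, a tail with the same [N] indices
   as [r]. *)
rewrite (@horner_coef_wide _ N.+2); last by rewrite -/N; lia.
rewrite !big_ord_recl /= /bump /= -/a0 -/a1.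
suff -> : \sum_(i < N) p`_(1 + (1 + i)) * (a0 / (a1 * W)) ^+ (1 + (1 + i))
  = a0 / W ^+ N.+1 * r.[W].
  have -> : r.[W] = - (W ^+ N * (W + 1)).
    apply/eqP; rewrite -addr_eq0 addrC -[X in _ == X]qW /q.
    by rewrite hornerD hornerM hornerXn hornerD hornerX hornerC.
  by rewrite expr0 expr1 [W ^+ N.+1]exprS; field; rewrite W0 a10 expf_neq0.
rewrite horner_sum mulr_sumr; apply: eq_bigr => i _.
rewrite hornerM hornerC hornerXn /c.
have -> : N.+1 = (i.+2 + (N.-1 - i))%N by have := ltn_ord i; lia.
rewrite !add1n exprD expr_div_n exprMn [a0 ^+ i.+2]exprS.
by field; rewrite !expf_neq0.
Qed.

(** * Taylor expansions and cancellation *)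

Hypothesis hnat : forall n, v n.+1%:R = 0%E.

Lemma valM_fact x n : v (x *+ n`!) = v x.
Proof.
by rewrite -mulr_natr valM -(prednK (fact_gt0 n)) hnat adde0.
Qed.

Lemma rveq_fact a b n : rveq (a *+ n`!) (b *+ n`!) -> rveq a b.
Proof.
rewrite -[a *+ _]mulr_natl -[b *+ _]mulr_natl; apply: rveq_cancel; last by left.
by rewrite -val_pinfty -(prednK (fact_gt0 n)) hnat.
Qed.

(** Factorials are units in residue characteristic 0. So families can be closed under iterated
    derivatives while Taylor sums use the divided ones. *)
Lemma val_nderivn (p : {poly K}) i x : v p^`N(i).[x] = v p^`(i).[x].
Proof. by rewrite nderivn_def hornerMn valM_fact. Qed.

Lemma valXN x n : v ((- x) ^+ n) = v (x ^+ n).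
Proof. by elim: n => [|n IH]; rewrite ?expr0 // !exprS !valM IH valN. Qed.

Lemma derivn_eq0 (p : {poly K}) i : (size p <= i)%N -> p^`(i) = 0.
Proof. by move=> h; rewrite nderivn_def nderivn_poly0 ?mul0rn. Qed.

Lemma derivnD (A : nzRingType) (p : {poly A}) i j : p^`(i)^`(j) = p^`(j + i).
Proof. by rewrite /derivn iterD. Qed.

Lemma taylor (p : {poly K}) n b z : (size p <= n)%N ->
  p.[b + z] = \sum_(i < n) p^`N(i).[b] * z ^+ i.
Proof. by move=> h; apply: nderiv_taylor_wide => //; apply: mulrC. Qed.

Lemma coef_comp_affine (p : {poly K}) b z i :
  (p \Po (b%:P + z *: 'X))`_i = p^`N(i).[b] * z ^+ i.
Proof.
rewrite /comp_poly (@nderiv_taylor_wide _ (size p + i.+1)); last first.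
- by rewrite size_map_polyC leq_addr.
- exact: mulrC.
have hi : (i < size p + i.+1)%N by rewrite addnS ltnS leq_addl.
rewrite coef_sum (bigD1 (Ordinal hi)) //= big1 => [|j ji].
  by rewrite nderivn_map horner_map /= exprZn coefCM coefZ coefXn eqxx mulr1 addr0.
rewrite nderivn_map horner_map /= exprZn coefCM coefZ coefXn.
case: eqP => [ij|_]; last by rewrite !mulr0.
by case/eqP: ji; apply: val_inj; rewrite /= -ij.
Qed.

(** A bound on all scaled derivatives survives a change of centre within the disc: expand each
    derivative at [b]. *)
Lemma val_derivn_shift_ge (F : {poly K}) b z g :
  (forall i, g <= v (F^`(i).[b] * z ^+ i))%E ->
  forall i, (g <= v (F^`(i).[b + z] * z ^+ i))%E.
Proof.
move=> h i; rewrite (taylor _ _ (leqnn _)) mulr_suml.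
apply: val_sum_ge => j _.
by rewrite -mulrA -exprD valM val_nderivn derivnD -valM.
Qed.

Lemma val_derivn_shift_gt (F : {poly K}) b z g : (g < +oo)%E ->
  (forall i, g < v (F^`(i).[b] * z ^+ i))%E ->
  forall i, (g < v (F^`(i).[b + z] * z ^+ i))%E.
Proof.
move=> g0 h i; rewrite (taylor _ _ (leqnn _)) mulr_suml.
apply: val_sum_gt => // j _.
by rewrite -mulrA -exprD valM val_nderivn derivnD -valM.
Qed.

(** Substituting [b + z + z X] and dividing by [m] gives an integral polynomial with constant term
    in the maximal ideal and unit linear coefficient. *)
Lemma hensel_disc (F : {poly K}) b z m : z != 0 -> m != 0 ->
  (forall i, v m <= v (F^`(i).[b] * z ^+ i))%E ->
  (v m < v F.[b + z])%E -> (v (F^`().[b + z] * z) <= v m)%E ->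
  exists c, root F c /\ (v z < v (c - (b + z)))%E.
Proof.
move=> z0 m0 hm hF hF'.
have hm' := val_derivn_shift_ge hm.
pose P := m^-1 *: (F \Po ((b + z)%:P + z *: 'X)).
have coefP i : P`_i = F^`N(i).[b + z] * z ^+ i / m.
  by rewrite coefZ coef_comp_affine mulrC.
have P1 : v P`_1 = 0%E.
  have e1 : v (F^`N(1).[b + z] * z ^+ 1) = v m.
    apply/eqP; rewrite eq_le valM val_nderivn -valM (hm' 1%N).
    by rewrite derivn1 expr1 hF'.
  by rewrite coefP valM e1 -valM mulfV // val1.
have [|||t [Pt ht]] := @hensel_at0 P.
- by move=> i; rewrite coefP val_div // valM val_nderivn -valM.
- by rewrite coefP val_div_gt // nderivn0 mulr1.
- by [].
exists (b + z + z * t); split; last first.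
  by rewrite addrAC subrr add0r -[X in v X]mulr1 ltr_valM // val1.
move/eqP: Pt; rewrite hornerZ mulf_eq0 invr_eq0 (negbTE m0) /= horner_comp.
by rewrite !hornerE.
Qed.

(* After scaling so that the dominant Taylor terms are units, 1 is a root of some
   multiplicity j + 1 of the reduction, hence a simple root of its j-th derivative. *)
Lemma root_of_cancellation (F : {poly K}) b z i : z != 0 ->
  (v (F^`(i).[b] * z ^+ i) < v F.[b + z])%E ->
  exists j c, [/\ F^`(j) != 0, root F^`(j) c & (v z < v (c - (b + z)))%E].
Proof.
move=> z0 hi; pose tm j := F^`(j).[b] * z ^+ j.
have iF : (i < size F)%N.
  rewrite ltnNge; apply: contraTN hi => /derivn_eq0 ->.
  by rewrite horner0 mul0r val0 -leNgt leey.
have [i0 _ mini0] := arg_minP (fun k : 'I_(size F) => v (tm k))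
  (erefl true : (xpredT (Ordinal iF))).
have {}mini0 k : (v (tm i0) <= v (tm k))%E.
  have [kF|Fk] := ltnP k (size F); first exact: (mini0 (Ordinal kF)).
  by rewrite /tm (derivn_eq0 Fk) horner0 mul0r val0 leey.
set m := tm i0 in mini0.
have hm : (v m < v F.[b + z])%E by apply: le_lt_trans (mini0 i) hi.
have m0 : m != 0 by rewrite -val_lt_pinfty; apply: lt_le_trans hm (leey _).
(* Otherwise all scaled derivatives at [b + z] exceed [m]. Shifting back by [- z], so does the one
   at [b] with index [i0], whose value is [m]. *)
have exj : exists j, (v (F^`(j).[b + z] * z ^+ j) <= v m)%E.
  apply: contrapT => /forallNP nj.
  have := @val_derivn_shift_gt F (b + z) (- z) (v m).
  rewrite val_lt_pinfty => /(_ m0) h.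
  have: (v m < v (F^`(i0).[b + z - z] * (- z) ^+ i0))%E.
    apply: h => j; rewrite [X in (_ < X)%E]valM valXN -valM.
    by rewrite ltNge; apply/negP.
  rewrite addrK [X in (_ < X)%E]valM valXN -valM.
  by rewrite ltxx.
(* The least index is positive by [hm]. Just below it, the derivative of order [j] is small at
   [b + z] while its own derivative is not, as Hensel's lemma requires. *)
case: (ex_minnP exj) => -[|j] hj minj.
  by move: hj; rewrite mulr1 leNgt hm.
have zj0 : z ^+ j != 0 by rewrite expf_neq0.
have F0 : F^`(j) != 0.
  apply: contraTneq hj => Fj0; rewrite derivnS Fj0 deriv0 horner0 mul0r val0.
  by rewrite -ltNge val_lt_pinfty.
have [||||c [rc hc]] := @hensel_disc F^`(j) b z (m / z ^+ j) z0.
- by rewrite mulf_neq0 ?invr_neq0.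
- move=> k; rewrite -(ler_valM _ _ zj0) mulrC divfK // mulrCA -exprD derivnD.
  by rewrite addnC; apply: mini0.
- rewrite -(ltr_valM _ _ zj0) mulrC divfK // ltNge; apply/negP => h.
  by have := minj j; rewrite mulrC h ltnn => /(_ isT).
- rewrite -(ler_valM _ _ zj0) [X in (_ <= v X)%E]mulrC divfK //.
  by rewrite mulrCA -exprSr -derivnS.
by exists j, c.
Qed.

(** * Centres closest to a point *)

Lemma roots_seq (p : {poly K}) : p != 0 ->
  exists rs : seq K, forall c, root p c = (c \in rs).
Proof.
have [n] := ubnP (size p); elim: n p => // n IH p szp p0.
have [[c rc]|nr] := pselect (exists c, root p c); last first.
  by exists [::] => c; apply/negP => rc; apply: nr; exists c.
case/factor_theorem: rc szp p0 => q -> szp; rewrite mulf_eq0 polyXsubC_eq0 orbF => q0.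
have [|rs hrs] := IH q _ q0; first by rewrite size_Mmonic ?monicXsubC // size_XsubC addn2 in szp.
by exists (c :: rs) => x; rewrite rootM root_XsubC hrs in_cons orbC.
Qed.

(** At least as close to [y] as 0 and as every root in [K] of a nonzero member of [Es]. That [b] can
    itself be taken among these is part of [best_center_ex]. *)
Definition best_center (Es : seq {poly K}) (y b : K) : Prop :=
  (v y <= v (y - b))%E /\
  forall H, H \in Es -> H != 0 -> forall c, root H c -> (v (y - c) <= v (y - b))%E.

Lemma best_center_ex (Es : seq {poly K}) y : exists b, best_center Es y b /\
  (b = 0 \/ exists H, [/\ H \in Es, H != 0 & root H b]).
Proof.
have maxc b0 (rs : seq K) : exists b, b \in b0 :: rs /\
    forall c, c \in b0 :: rs -> (v (y - c) <= v (y - b))%E.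
  elim: rs b0 => [|x rs IH] b0.
    by exists b0; split=> [|c]; rewrite !inE // => /eqP->.
  have [b [hb mb]] := IH x; have [h|h] := leP (v (y - b0)) (v (y - b)).
    exists b; rewrite in_cons hb orbT; split=> // c.
    by rewrite in_cons => /orP[/eqP->|/mb].
  exists b0; rewrite mem_head; split=> // c.
  by rewrite in_cons => /orP[/eqP->//|/mb]; move/le_trans; apply; apply: ltW.
elim: Es => [|H Es [b [[b0 bE] bO]]].
  by exists 0; split; [split=> //; rewrite subr0|left].
have [H0|H0] := eqVneq H 0.
  exists b; split; first split=> // H' /[!inE] /orP[/eqP->|]; rewrite ?H0 ?eqxx //.
    exact: bE.
  case: bO => [|[H' [H'E ? ?]]]; [by left|right; exists H'; split=> //].
  by rewrite in_cons H'E orbT.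
have [rs hrs] := roots_seq H0; have [c [cin mc]] := maxc b rs.
exists c; split; first split.
- by apply: le_trans b0 _; apply: mc; rewrite mem_head.
- move=> H' /[!inE] /orP[/eqP-> _ x|H'E H'0 x rx].
    by rewrite hrs => xrs; apply: mc; rewrite in_cons xrs orbT.
  by apply: le_trans (bE _ H'E H'0 _ rx) _; apply: mc; rewrite mem_head.
- move: cin; rewrite in_cons => /orP[/eqP->|]; last first.
    by rewrite -hrs => rc; right; exists H; rewrite mem_head.
  case: bO => [|[H' [H'E ? ?]]]; [by left|right; exists H'; split=> //].
  by rewrite in_cons H'E orbT.
Qed.

(** A cancellation would produce a root of some derivative strictly closer to [b + z] than [b]
    is. *)
Lemma best_center_no_cancellation (Es : seq {poly K}) b z F :
  {in Es, forall H i, H^`(i) \in Es} ->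
  best_center Es (b + z) b -> z != 0 -> F \in Es ->
  forall i, (v F.[b + z] <= v (F^`(i).[b] * z ^+ i))%E.
Proof.
move=> cl [_ bE] z0 FE i; rewrite leNgt; apply/negP.
case/(root_of_cancellation z0) => j [c [Fj0 rc]].
have := bE _ (cl _ FE j) Fj0 c rc.
by rewrite [b + z - b]addrAC subrr add0r valB leNgt => /negbTE->.
Qed.

(** * Transfer along rv-equivalent Taylor coefficients *)

Lemma rveq_derivn (F F' : {poly K}) b b' i :
  rveq F^`(i).[b] F'^`(i).[b'] -> rveq F^`N(i).[b] F'^`N(i).[b'].
Proof. by rewrite !nderivn_def !hornerMn => /rveq_fact. Qed.

Lemma rveq_horner (F F' : {poly K}) b b' z z' :
  (forall i, rveq F^`(i).[b] F'^`(i).[b']) -> rveq z z' ->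
  (forall i, v F.[b + z] <= v (F^`(i).[b] * z ^+ i))%E ->
  rveq F.[b + z] F'.[b' + z'].
Proof.
(* The degrees of [F] and [F'] may differ, so both sums are padded to a common length. *)
move=> hb hz; rewrite (taylor _ _ (leq_maxl (size F) (size F'))).
rewrite (taylor _ _ (leq_maxr (size F) (size F'))) => hle.
apply: rveq_sum => i; first by apply: rveqM (rveqX _ hz); apply: rveq_derivn.
by apply: le_trans (hle i) _; rewrite !valM val_nderivn.
Qed.

(** This serves when the Taylor sum cancels, as at a root of [F]: only the difference of the two
    values is controlled, by a bound common to all terms. *)
Lemma rveq_horner_close (F F' : {poly K}) b b' z g :
  (forall i, rveq F^`(i).[b] F'^`(i).[b']) -> (g < +oo)%E ->
  (forall i, g <= v (F^`(i).[b] * z ^+ i))%E ->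
  (g < v (F'.[b' + z] - F.[b + z]))%E.
Proof.
move=> hb g0 hg; rewrite valB (taylor _ _ (leq_maxl (size F) (size F'))).
rewrite (taylor _ _ (leq_maxr (size F) (size F'))) -sumrB.
apply: val_sum_gt => // i _; rewrite -mulrBl.
case: (rveq_derivn (hb i)) => [->|h]; first by rewrite subrr mul0r val0.
have [z0|z0] := eqVneq (z ^+ i) 0; first by rewrite z0 mulr0 val0.
apply: (@le_lt_trans _ _ (v (F^`(i).[b] * z ^+ i))) => //.
by rewrite valM -val_nderivn -valM ![_ * z ^+ i]mulrC ltr_valM.
Qed.

(* The last hypothesis says that F^`() does not cancel at b + z, which makes
   b + z a simple root of the reduction; this is a condition on rv-classes, so it
   passes to F' and Hensel's lemma applies there. *)
Lemma root_transfer (F F' : {poly K}) b b' z : z != 0 -> F != 0 ->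
  (forall i, rveq F^`(i).[b] F'^`(i).[b']) -> F.[b + z] = 0 ->
  (forall i, v F^`().[b + z] <= v (F^`()^`(i).[b] * z ^+ i))%E ->
  exists z', root F' (b' + z') /\ rveq z z'.
Proof.
move=> z0 F0 hb Fz hF'; pose m := F^`().[b + z] * z.
have hm1 i : (v m <= v (F^`(i.+1).[b] * z ^+ i.+1))%E.
  rewrite exprS mulrCA /m mulrC ler_valM //.
  by have := hF' i; rewrite -derivSn.
(* The constant term is covered too: as [F] vanishes at [b + z], it is minus the sum of the
   others. *)
have hm i : (v m <= v (F^`(i).[b] * z ^+ i))%E.
  case: i => [|i] //; move: Fz.
  rewrite (taylor _ _ (leqnSn (size F))) big_ord_recl => /eqP.
  rewrite addr_eq0 nderivn0 => /eqP ->; rewrite valN.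
  apply: val_sum_ge => i _.
  by rewrite [X in (_ <= X)%E]valM val_nderivn -valM; apply: hm1.
(* Otherwise all Taylor coefficients at [b] vanish, and [F] with them. *)
have m0 : m != 0.
  apply: contra F0 => /eqP m0; rewrite -size_poly_eq0.
  rewrite -(@size_comp_poly2 _ F (b%:P + z *: 'X)); last first.
    by rewrite addrC size_polyDl size_scale ?size_polyX ?size_polyC //; case: (_ != _).
  rewrite size_poly_eq0; apply/eqP/polyP => i.
  rewrite coef_comp_affine coef0; apply/eqP.
  by have := hm i; rewrite m0 val0 leye_eq -val_pinfty !valM val_nderivn.
have [|||c [rc hc]] := @hensel_disc F' b' z m z0 m0.
- by move=> i; have := hm i; rewrite !valM (rveq_val (hb i)).
- have := rveq_horner_close hb _ hm; rewrite val_lt_pinfty Fz subr0.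
  exact.
- have h1 : rveq F^`().[b + z] F'^`().[b' + z].
    apply: rveq_horner; [|exact: rveq_refl|exact: hF'].
    by move=> i; rewrite -!derivSn; apply: hb.
  by rewrite /m !valM (rveq_val h1).
exists (c - b'); split; first by rewrite addrC subrK.
by right; rewrite valB -addrA -opprD.
Qed.

(** * Polynomials with parameters, specialised in two ways *)

Section Specialization.
Variable A : comNzRingType.
Implicit Types (s : {rmorphism A -> K}) (F G H : {poly A}) (qs : seq A).

Definition agree qs s s' : Prop := {in qs, forall q, rveq (s q) (s' q)}.

Lemma agree_cat qs1 qs2 s s' :
  agree (qs1 ++ qs2) s s' -> agree qs1 s s' /\ agree qs2 s s'.
Proof. by move=> h; split=> q hq; apply: h; rewrite mem_cat hq ?orbT. Qed.

Lemma agree_collect (T : eqType) (E : seq T)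
    (P : T -> {rmorphism A -> K} -> {rmorphism A -> K} -> Prop) :
  {in E, forall x, exists qs, forall s s', agree qs s s' -> P x s s'} ->
  exists qs, forall s s', agree qs s s' -> {in E, forall x, P x s s'}.
Proof.
elim: E => [|x E IH] h; first by exists [::].
have [q1 h1] := h x (mem_head _ _).
have [|q2 h2] := IH; first by move=> y yE; apply: h; rewrite in_cons yE orbT.
exists (q1 ++ q2) => s s' /agree_cat[/h1 hx /h2 hE] y.
by rewrite in_cons => /orP[/eqP->|/hE].
Qed.

(** The statement for the induction on the degree of [G]; [qs] is uniform in [s], [s'] and [c]. That
    [c'] is a root of the image of [G] follows when [G] is in [Fs], since rv-equivalence preserves
    vanishing. *)
Definition transfers_roots G (Fs : seq {poly A}) : Prop :=
  exists qs, forall s s', agree qs s s' -> map_poly s G != 0 ->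
    forall c, root (map_poly s G) c ->
    exists c', {in Fs, forall F, rveq (map_poly s F).[c] (map_poly s' F).[c']}.

(** The range includes the order [size F], where the derivative is 0, so that the list is closed
    under all derivatives. *)
Definition derivatives (Fs : seq {poly A}) : seq {poly A} :=
  flatten [seq [seq F^`(j) | j <- iota 0 (size F).+1] | F <- Fs].

Lemma mem_derivatives Fs F i : F \in Fs -> F^`(i) \in derivatives Fs.
Proof.
move=> hF; apply/flatten_mapP; exists F => //; apply/mapP.
have [iF|Fi] := leqP i (size F).
  by exists i => //; rewrite mem_iota add0n ltnS.
exists (size F); first by rewrite mem_iota leqnn.
by rewrite !nderivn_def !nderivn_poly0 ?mul0rn // ltnW.
Qed.

Lemma derivatives_closed Fs : {in derivatives Fs, forall F i, F^`(i) \in derivatives Fs}.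
Proof.
move=> _ /flatten_mapP[F hF /mapP[j _ ->]] i.
by rewrite derivnD; apply: mem_derivatives.
Qed.

Lemma size_derivatives Fs d : {in Fs, forall F, size F <= d}%N ->
  {in derivatives Fs, forall F, size F <= d}%N.
Proof.
move=> h _ /flatten_mapP[F hF /mapP[j _ ->]]; apply: leq_trans (h _ hF).
elim: j => [|j IH] //; rewrite derivnS; apply: leq_trans IH.
have [->|F0] := eqVneq F^`(j) 0; first by rewrite deriv0.
by rewrite ltnW // lt_size_deriv.
Qed.

Lemma map_derivatives_closed Fs s :
  {in map (map_poly s) (derivatives Fs),
    forall (F : {poly K}) i, F^`(i) \in map (map_poly s) (derivatives Fs)}.
Proof.
move=> _ /mapP[F hF ->] i; rewrite derivn_map map_f //.
exact: derivatives_closed.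
Qed.

(** A best centre is 0 or a root of a member of [E]. Roots transfer by hypothesis; at 0 the values
    are constant coefficients, which are added to [qs]. *)
Lemma transfer_best_center (E Fs : seq {poly A}) :
  {in E, forall H, transfers_roots H Fs} ->
  exists qs, forall s s', agree qs s s' -> forall y, exists b b',
    best_center (map (map_poly s) E) y b /\
    {in Fs, forall F, rveq (map_poly s F).[b] (map_poly s' F).[b']}.
Proof.
move=> /agree_collect[qs hqs]; exists (map (fun F => F`_0) Fs ++ qs).
move=> s s' /agree_cat[h0 /hqs hE] y.
have [b [bc [b0|[_ [/mapP[H HE ->] H0 rb]]]]] := best_center_ex (map (map_poly s) E) y.
  exists b, 0; split=> // F hF; rewrite b0 !horner_coef0 !coef_map.
  by apply: h0; apply: map_f.
by have [b' hb'] := hE _ HE H0 _ rb; exists b, b'.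
Qed.

Lemma transfers_rootsP G Fs : transfers_roots G Fs.
Proof.
have [d] := ubnP (size G); elim: d => // d IH in G Fs *; rewrite ltnS.
rewrite leq_eqVlt => /orP[/eqP szG|/IH //].
case: d => [|d] in szG IH.
  move/eqP: szG; rewrite size_poly_eq0 => /eqP ->; exists [::] => s s' _.
  by rewrite rmorph0 eqxx.
set a := lead_coef G; pose red F := Pdiv.Ring.rmodp F G.
have G0 : G != 0 by rewrite -size_poly_gt0 szG.
have redP F s : let k := Pdiv.Ring.rscalp F G in forall c, root (map_poly s G) c ->
    s a ^+ k * (map_poly s F).[c] = (map_poly s (red F)).[c].
  move=> k c /eqP rc; have := Pdiv.ComRing.rdivp_eq G F.
  move/(congr1 (fun p => (map_poly s p).[c])).
  by rewrite rmorphD rmorphM /= map_polyZ rmorphXn !hornerE rc mulr0 add0r.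
pose E := derivatives (G^`() :: map red Fs).
have szE : {in E, forall H, size H < d.+1}%N.
  apply: size_derivatives => H; rewrite in_cons => /orP[/eqP->|/mapP[F _ ->]].
    by rewrite -ltnS -szG lt_size_deriv.
  by rewrite -ltnS -szG Pdiv.Ring.ltn_rmodp.
(* The candidates for the centre are 0 and the roots of [E] only, but the value of [G] at the centre
   must transfer as well. *)
have [qs1 hqs1] := @transfer_best_center E (G :: E) (fun H hH => IH H _ (szE _ hH)).
(* For the case [s a = 0], where [G] and [G1] have the same image. *)
pose G1 := G - a *: 'X^d.
have [|qs2 hqs2] := IH G1 Fs.
  rewrite ltnS; apply/leq_sizeP => j; rewrite leq_eqVlt coefB coefZ coefXn.
  move=> /orP[/eqP<-|dj]; first by rewrite eqxx mulr1 /a lead_coefE szG subrr.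
  by rewrite gtn_eqF // mulr0 subr0 nth_default // szG.
exists (a :: qs1 ++ qs2) => s s' hag Gs0 c rc.
have aa' : rveq (s a) (s' a) by apply: hag; rewrite mem_head.
have [h1 h2] : agree qs1 s s' /\ agree qs2 s s'.
  by apply: agree_cat => q hq; apply: hag; rewrite in_cons hq orbT.
have [sa0|sa0] := eqVneq (s a) 0.
  have GG1 : map_poly s G = map_poly s G1.
    by rewrite rmorphB /= map_polyZ sa0 scale0r subr0.
  by apply: (hqs2 s s'); rewrite -?GG1.
have s'a0 : s' a != 0 by rewrite -(rveq_eq0 aa').
have [b [b' [bc hb]]] := hqs1 s s' h1 c.
(* At roots of [G], members of [Fs] take the values of their remainders up to powers of [a], whose
   rv-class is fixed. *)
suff [c' [rc' hc']] : exists c', root (map_poly s' G) c' /\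
    {in E, forall H, rveq (map_poly s H).[c] (map_poly s' H).[c']}.
  exists c' => F hF.
  apply: (rveq_cancel _ (rveqX (Pdiv.Ring.rscalp F G) aa')); first exact: expf_neq0.
  rewrite !redP //; apply: hc'; apply: (@mem_derivatives _ (red F) 0).
  by rewrite in_cons (map_f red hF) orbT.
have hbE : {in E, forall H, rveq (map_poly s H).[b] (map_poly s' H).[b']}.
  by move=> H hH; apply: hb; rewrite in_cons hH orbT.
have hbE' : {in E, forall H i, rveq (map_poly s H)^`(i).[b] (map_poly s' H)^`(i).[b']}.
  by move=> H hH i; rewrite !derivn_map; apply: hbE; apply: derivatives_closed.
have hbG i : rveq (map_poly s G)^`(i).[b] (map_poly s' G)^`(i).[b'].
  case: i => [|i]; first by rewrite !derivn0; apply: hb; rewrite mem_head.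
  rewrite !derivSn !deriv_map; apply: hbE'; apply: (@mem_derivatives _ _ 0).
  exact: mem_head.
have [z0|z0] := eqVneq (c - b) 0.
  move/eqP: z0; rewrite subr_eq0 => /eqP cb; exists b'; rewrite cb; split=> //.
  by apply/rootP; apply: rveq0 (hbG 0%N) _; apply/rootP; rewrite -cb.
have cE : c = b + (c - b) by rewrite addrC subrK.
set z := c - b in z0 cE; rewrite cE in bc rc *.
have nc H : H \in E -> forall i,
    (v (map_poly s H).[b + z] <= v ((map_poly s H)^`(i).[b] * z ^+ i))%E.
  move=> HE; apply: (best_center_no_cancellation _ bc z0); last exact: map_f.
  exact: map_derivatives_closed.
have [|z' [rz' zz']] := @root_transfer (map_poly s G) (map_poly s' G) b b' z z0 Gs0 hbG (rootP rc).
  by rewrite deriv_map; apply: nc; apply: (@mem_derivatives _ _ 0); apply: mem_head.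
exists (b' + z'); split=> // H HE; apply: rveq_horner zz' (nc _ HE).
exact: hbE'.
Qed.

(** Transfer a best centre [b] of [y] to [b'] and keep the offset [y - b]. No member of [ps] cancels
    there, so its Taylor coefficients at the centre determine its rv-class. *)
Theorem rveq_transfer (ps : seq {poly A}) :
  exists qs, forall s s', agree qs s s' -> forall y, exists y',
    {in ps, forall F, rveq (map_poly s F).[y] (map_poly s' F).[y']}.
Proof.
pose E := derivatives ps.
have [qs hqs] := @transfer_best_center E E (fun H _ => transfers_rootsP H E).
exists qs => s s' /hqs h y; have [b [b' [bc hb]]] := h y.
have psE F : F \in ps -> F \in E by move=> hF; apply: (@mem_derivatives _ _ 0).
have yE : y = b + (y - b) by rewrite addrC subrK.
exists (b' + (y - b)) => F hF.
have [z0|z0] := eqVneq (y - b) 0.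
  by rewrite [in X in rveq X]yE z0 !addr0; apply/hb/psE.
rewrite [in X in rveq X]yE; apply: rveq_horner; last 1 first.
- rewrite [X in best_center _ X]yE in bc.
  apply: (best_center_no_cancellation _ bc z0); last exact/map_f/psE.
  exact: map_derivatives_closed.
- by move=> i; rewrite !derivn_map; apply: hb; apply: mem_derivatives.
- exact: rveq_refl.
Qed.

End Specialization.

End Valuation.

(** * The ring of polynomial functions on environments *)

(* The coefficient ring: all polynomial functions of an environment, with no
   bound on the variables involved. *)
Section TermFunctions.
Variable K : fieldType.

(** Functions rather than syntactic terms, so that the ring laws are inherited from the ring of
    functions. *)
Definition is_term_fun : {pred (nat -> K) -> K} :=
  fun f => `[< exists t : tK K, f = fun e => evK e t >].

Fact is_term_fun_subring : subring_closed is_term_fun.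
Proof.
split=> [|f g /asboolP[t ->] /asboolP[u ->]|f g /asboolP[t ->] /asboolP[u ->]].
- by apply/asboolP; exists (KOne K).
- by apply/asboolP; exists (KAdd t (KOpp u)).
- by apply/asboolP; exists (KMul t u).
Qed.

HB.instance Definition _ :=
  GRing.isSubringClosed.Build ((nat -> K) -> K) is_term_fun is_term_fun_subring.

Record termFun := TermFun { fun_of_termFun :> (nat -> K) -> K;
  _ : fun_of_termFun \in is_term_fun }.

HB.instance Definition _ := [isSub for fun_of_termFun].
HB.instance Definition _ := [Choice of termFun by <:].
HB.instance Definition _ := 
  GRing.SubChoice_isSubComPzRing.Build _ _ termFun is_term_fun_subring.

Fact termFun1_neq0 : (1 : termFun) != 0.
Proof. by apply/eqP=> /(congr1 (fun f : termFun => f (fun=> 0)))/eqP; rewrite oner_eq0. Qed.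
HB.instance Definition _ :=
  GRing.PzSemiRing_isNonZero.Build termFun termFun1_neq0.

Definition tf_eval (e : nat -> K) (f : termFun) : K := f e.

Fact tf_eval_add e : zmod_morphism (tf_eval e). Proof. by []. Qed.
Fact tf_eval_mul e : monoid_morphism (tf_eval e). Proof. by []. Qed.
HB.instance Definition _ e :=
  GRing.isZmodMorphism.Build termFun K (tf_eval e) (@tf_eval_add e).
HB.instance Definition _ e :=
  GRing.isMonoidMorphism.Build termFun K (tf_eval e) (@tf_eval_mul e).

Lemma term_funP (f : termFun) : exists t, forall e, f e = evK e t.
Proof. by case: f => f /= /asboolP[t ->]; exists t. Qed.

Fact mem_is_term_fun (t : tK K) : (fun e => evK e t) \in is_term_fun.
Proof. by apply/asboolP; exists t. Qed.

Definition term_fun (t : tK K) : termFun := TermFun (mem_is_term_fun t).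

(** Isolates variable [i] as an indeterminate, to treat a quantifier over it. *)
Lemma term_fun_poly i (f : termFun) :
  exists p : {poly termFun}, forall e y, (map_poly (tf_eval e) p).[y] = f (upd e i y).
Proof.
have [t ht] := term_funP f.
suff [p hp] : exists p : {poly termFun}, forall e y,
    (map_poly (tf_eval e) p).[y] = evK (upd e i y) t by exists p => e y; rewrite hp ht.
elim: t {f ht} => [j|c|||t [p hp] u [q hq]|t [p hp]|t [p hp] u [q hq]] /=.
- exists (if j == i then 'X else (term_fun (KVar K j))%:P) => e y.
  rewrite /upd; case: ifP => _; first by rewrite map_polyX hornerX.
  by rewrite map_polyC hornerC.
- by exists (term_fun (KConst c))%:P => e y; rewrite map_polyC hornerC.
- by exists 0 => e y; rewrite rmorph0 horner0.
- by exists 1 => e y; rewrite rmorph1 hornerC.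
- by exists (p + q) => e y; rewrite rmorphD hornerD hp hq.
- by exists (- p) => e y; rewrite rmorphN hornerN hp.
- by exists (p * q) => e y; rewrite rmorphM hornerM hp hq.
Qed.

End TermFunctions.

(** * Formulas depend on finitely many rv-classes *)

Section DenefPas.
Variables (K k : fieldType) (R : realType) (v : K -> \bar R) (res ac : K -> k).
Variables (L : augmentation) (I : aug_interp L R k).
Hypotheses (hv : is_valuation v) (hhens : henselian v).
Hypotheses (hchark : [pchar k] =i pred0).
Hypotheses (hres : residue_map v res) (hac : angular_component v res ac).

(** A positive integer in the maximal ideal would be 0 in [k]. *)
Lemma val_natS n : v n.+1%:R = 0%E.
Proof.
case: hres => resD _ res1 res0 _.
have vn m : (0 <= v m%:R)%E.
  elim: m => [|m IH]; first by rewrite val0 // leey.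
  by rewrite mulrS; apply: valD_ge => //; rewrite val1.
have v1 : (0 <= v 1)%E by rewrite val1.
have resn m : res m%:R = m%:R.
  elim: m => [|m IH]; first by apply/res0; rewrite val0 ?leey ?ltry.
  by rewrite !mulrS resD // res1 IH.
apply/eqP; rewrite eq_le vn andbT leNgt; apply/negP => /(res0 _ (vn _)).
by apply/eqP; rewrite resn; move/pcharf0P: hchark => ->.
Qed.

(** The quotient [b / a] lies in 1 + m, where [ac] is the residue 1. *)
Lemma rveq_ac a b : rveq v a b -> ac a = ac b.
Proof.
case: hac => acM _ ac1; case: hres => resD _ res1 res0 _.
case=> [->//|h]; have a0 : a != 0.
  by rewrite -(val_lt_pinfty hv); apply: lt_le_trans h (leey _).
have v1 : (0 <= v 1)%E by rewrite val1.
have hu : (0 < v (b / a - 1))%E.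
  by rewrite -(divff a0) -mulrBl val_div_gt // valB.
have vb : v (b / a) = 0%E.
  by rewrite -[b / a](subrK 1) addrC valD_eq0 // val1.
suff ac_ba : ac (b / a) = 1 by rewrite -[b](divfK a0) acM ac_ba mul1r.
rewrite ac1 // -[b / a](subrK 1) resD ?(ltW hu) // res1.
by move/(res0 _ (ltW hu)): (hu) => ->; rewrite add0r.
Qed.

Notation agree_env qs e e' := (agree v qs (tf_eval e) (tf_eval e')).

Lemma agree_env_sym qs e e' : agree_env qs e e' -> agree_env qs e' e.
Proof. by move=> h q /h; apply: rveq_sym. Qed.

Lemma agree_env_ord n (P : 'I_n -> (nat -> K) -> (nat -> K) -> Prop) :
  (forall j, exists qs, forall e e', agree_env qs e e' -> P j e e') ->
  exists qs, forall e e', agree_env qs e e' -> forall j, P j e e'.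
Proof.
move=> /choice[q hq]; exists (flatten [seq q j | j <- enum 'I_n]) => e e' h j.
apply: hq => x xq; apply: h; apply/flatten_mapP; exists j => //.
by rewrite mem_enum.
Qed.

Lemma agree_env_and (P Q : (nat -> K) -> (nat -> K) -> Prop) :
  (exists qs, forall e e', agree_env qs e e' -> P e e') ->
  (exists qs, forall e e', agree_env qs e e' -> Q e e') ->
  exists qs, forall e e', agree_env qs e e' -> P e e' /\ Q e e'.
Proof.
move=> [q hq] [r hr]; exists (q ++ r) => e e' h.
by split; [apply: hq|apply: hr] => x hx; apply: h; rewrite mem_cat hx ?orbT.
Qed.

Lemma evG_determined (t : tG K L) : exists qs, forall e e',
  agree_env qs e e' -> forall eg, evG v I e eg t = evG v I e' eg t.
Proof.
elim: t => [j|u|||t IHt u IHu|s args /agree_env_ord[qs IH]] /=.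
- by exists [::].
- exists [:: term_fun u] => e e' h eg; apply: rveq_val hv _ _ _.
  by apply: (h (term_fun u)); rewrite mem_head.
- by exists [::].
- by exists [::].
- have [qs h] := agree_env_and IHt IHu; exists qs => e e' /h[ht hu] eg.
  by rewrite ht hu.
- exists qs => e e' h eg; congr gfun_i; apply: funext => j; exact: IH.
Qed.

Lemma evk_determined (t : tk K k L) : exists qs, forall e e',
  agree_env qs e e' -> forall ek, evk ac I e ek t = evk ac I e' ek t.
Proof.
elim: t => [j|c|u|||t IHt u IHu|t [qs IH]|t IHt u IHu|s args /agree_env_ord[qs IH]] /=.
- by exists [::].
- by exists [::].
- exists [:: term_fun u] => e e' h ek; apply: rveq_ac.
  by apply: (h (term_fun u)); rewrite mem_head.
- by exists [::].
- by exists [::].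
- have [qs h] := agree_env_and IHt IHu; exists qs => e e' /h[ht hu] eg.
  by rewrite ht hu.
- by exists qs => e e' /IH h ek; rewrite h.
- have [qs h] := agree_env_and IHt IHu; exists qs => e e' /h[ht hu] eg.
  by rewrite ht hu.
- exists qs => e e' h eg; congr kfun_i; apply: funext => j; exact: IH.
Qed.

(** Equations are decided by the vanishing of a difference, and [qs] is uniform in [eg] and [ek], so
    quantifiers over the other two sorts keep the same list. *)
Theorem sat_determined (phi : Defs.form K k L) : exists qs, forall e e',
  agree_env qs e e' -> forall eg ek, sat v ac I e eg ek phi <-> sat v ac I e' eg ek phi.
Proof.
elim: phi => [t u|t u|t u|t u|s args|s args|p [qs IH]|p IHp q IHq|i p [qs IH]
  |i p [qs IH]|i p [qs IH]] /=.
- exists [:: term_fun t - term_fun u] => e e' h eg ek.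
  have /(rveq_eq0 hv) : rveq v (evK e t - evK e u) (evK e' t - evK e' u).
    by apply: (h (term_fun t - term_fun u)); rewrite mem_head.
  rewrite !subr_eq0 => E.
  by split=> /eqP; [rewrite E|rewrite -E] => /eqP.
- have [qs h] := agree_env_and (evG_determined t) (evG_determined u).
  by exists qs => e e' /h[ht hu] eg ek; rewrite ht hu.
- have [qs h] := agree_env_and (evG_determined t) (evG_determined u).
  by exists qs => e e' /h[ht hu] eg ek; rewrite ht hu.
- have [qs h] := agree_env_and (evk_determined t) (evk_determined u).
  by exists qs => e e' /h[ht hu] eg ek; rewrite ht hu.
- have [qs h] := agree_env_ord (fun j => evG_determined (args j)).
  exists qs => e e' /h E eg ek.
  by have -> : (fun j => evG v I e eg (args j)) = (fun j => evG v I e' eg (args j))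
    by apply: funext.
- have [qs h] := agree_env_ord (fun j => evk_determined (args j)).
  exists qs => e e' /h E eg ek.
  by have -> : (fun j => evk ac I e ek (args j)) = (fun j => evk ac I e' ek (args j))
    by apply: funext.
- by exists qs => e e' /IH h eg ek; rewrite h.
- have [qs h] := agree_env_and IHp IHq.
  by exists qs => e e' /h[hp hq] eg ek; rewrite hp hq.
(* A witness for the field quantifier is moved by [rveq_transfer], which eliminates variable [i]
   from the list. *)
- have /choice[F hF] := @term_fun_poly K i.
  have [rs hrs] := rveq_transfer hv hhens val_natS (map F qs).
  suff half e e' eg ek : agree_env rs e e' ->
      (exists x, sat v ac I (upd e i x) eg ek p) ->
      exists x, sat v ac I (upd e' i x) eg ek p.
    by exists rs => e e' h eg ek; split; apply: half => //; apply: agree_env_sym.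
  move=> /hrs h [y sat_y]; have [y' hy'] := h y; exists y'.
  suff /IH/(_ eg ek)[hsat _] : agree_env qs (upd e i y) (upd e' i y') by apply: hsat.
  by move=> q hq; have := hy' _ (map_f F hq); rewrite !hF.
- by exists qs => e e' /IH h eg ek; split=> -[x /h hx]; exists x.
- by exists qs => e e' /IH h eg ek; split=> -[x /h hx]; exists x.
Qed.

End DenefPas.

(** * Continuity of polynomial functions and generic points *)

Section Topology.
Variables (K : fieldType) (R : realType) (v : K -> \bar R).
Hypotheses (hv : is_valuation v) (hrank1 : nontrivial_valuation v).

Definition near (e : nat -> K) (g : R) (e' : nat -> K) : Prop :=
  forall i, (g%:E < v (e' i - e i))%E.

Lemma near_le e g g' e' : g <= g' -> near e g' e' -> near e g e'.
Proof. by move=> gg h i; apply: le_lt_trans (h i); rewrite lee_fin. Qed.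

Lemma near_all (T : eqType) (s : seq T) e (P : T -> (nat -> K) -> Prop) :
  {in s, forall q, exists g, forall e', near e g e' -> P q e'} ->
  exists g, forall e', near e g e' -> {in s, forall q, P q e'}.
Proof.
elim: s => [|x s IH] h; first by exists 0.
have [g1 h1] := h x (mem_head _ _).
have [|g2 h2] := IH; first by move=> y ys; apply: h; rewrite in_cons ys orbT.
exists (Num.max g1 g2) => e' he' y; rewrite in_cons => /orP[/eqP->|].
  by apply/h1/(near_le _ he'); rewrite le_max lexx.
by apply/h2/(near_le _ he'); rewrite le_max lexx orbT.
Qed.

Definition cont_at (e : nat -> K) (F : (nat -> K) -> K) : Prop :=
  forall g : R, exists d : R, forall e', near e d e' -> (g%:E < v (F e' - F e))%E.

Lemma cont_at_cst e c : cont_at e (fun=> c).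
Proof. by move=> g; exists 0 => e' _; rewrite subrr val0 // ltry. Qed.

Lemma cont_at_add e F G : cont_at e F -> cont_at e G -> cont_at e (fun x => F x + G x).
Proof.
move=> hF hG g; have [d1 h1] := hF g; have [d2 h2] := hG g.
exists (Num.max d1 d2) => e' he'; rewrite opprD addrACA; apply: valD_gt => //.
  by apply/h1/(near_le _ he'); rewrite le_max lexx.
by apply/h2/(near_le _ he'); rewrite le_max lexx orbT.
Qed.

Lemma cont_at_opp e F : cont_at e F -> cont_at e (fun x => - F x).
Proof.
move=> hF g; have [d h] := hF g; exists d => e' /h.
by rewrite -opprD valN.
Qed.

Lemma valM_gt_ex c (g : R) :
  exists d : R, forall x, (d%:E < v x)%E -> (g%:E < v (c * x))%E.
Proof.
have [->|c0] := eqVneq c 0; first by exists 0 => x _; rewrite mul0r val0 // ltry.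
have := val_fin hv c0; case E : (v c) => [r| |] // _.
exists (g - r) => x; rewrite valM // E; case: (v x) => [y| |].
- by rewrite -EFinD !lte_fin ltrBlDl.
- by rewrite addey // !ltry.
- by rewrite ltNge leNye.
Qed.

Lemma cont_at_mul e F G : cont_at e F -> cont_at e G -> cont_at e (fun x => F x * G x).
Proof.
move=> hF hG g; have [d1 h1] := valM_gt_ex (F e) g; have [d2 h2] := valM_gt_ex (G e) g.
have [n1 k1] := hG d1; have [n2 k2] := hF d2.
have [n3 k3] := hF g; have [n4 k4] := hG 0.
exists (Num.max (Num.max n1 n2) (Num.max n3 n4)) => e' he'.
have {}k1 := k1 e' (near_le _ he'); have {}k2 := k2 e' (near_le _ he').
have {}k3 := k3 e' (near_le _ he'); have {}k4 := k4 e' (near_le _ he').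
have -> : F e' * G e' - F e * G e = (F e' - F e) * (G e' - G e) +
  (F e * (G e' - G e) + G e * (F e' - F e)) by ring.
apply: valD_gt => //; last apply: valD_gt => //.
- rewrite valM //; apply: lt_le_trans (k3 _) _; first by rewrite !le_max lexx !orbT.
  by rewrite leeDl // ltW // k4 // !le_max lexx !orbT.
- by apply/h1/k1; rewrite !le_max lexx.
- by apply/h2/k2; rewrite !le_max lexx !orbT.
Qed.

Lemma cont_at_term e t : cont_at e (fun x => evK x t).
Proof.
elim: t => [i|c|||t ht u hu|t ht|t ht u hu] /=; try exact: cont_at_cst.
- by move=> g; exists g => e' /(_ i).
- exact: cont_at_add.
- exact: cont_at_opp.
- exact: cont_at_mul.
Qed.

Lemma cont_at_term_fun e (f : termFun K) : cont_at e f.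
Proof.
have [t ht] := term_funP f; move=> g; have [d hd] := @cont_at_term e t g.
by exists d => e' /hd; rewrite !ht.
Qed.

Lemma cont_at_horner e (q : {poly termFun K}) w :
  cont_at e (fun x => (map_poly (tf_eval x) q).[w]).
Proof.
elim/poly_ind: q => [|q c IH] g.
  by exists 0 => e' _; rewrite !rmorph0 !horner0 subrr val0 // ltry.
have [d hd] := cont_at_add (cont_at_mul IH (cont_at_cst e w)) (@cont_at_term_fun e c) g.
exists d => e' /hd; rewrite !rmorphD !rmorphM /= !map_polyX !map_polyC /=.
by rewrite !hornerD !hornerM !hornerX !hornerC.
Qed.

(** The rv-class is locally constant away from 0: take the radius for the bound [v (F e)]. *)
Lemma cont_at_rveq e F : cont_at e F -> F e != 0 ->
  exists g, forall e', near e g e' -> rveq v (F e) (F e').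
Proof.
move=> hF F0; have := val_fin hv F0; case E : (v (F e)) => [r| |] // _.
have [d hd] := hF r; exists d => e' /hd h; right.
by rewrite E valB.
Qed.

(** Powers of an element of positive valuation suffice, since [R] is Archimedean. *)
Lemma val_unbounded (g : R) : exists d, d != 0 /\ (g%:E < v d)%E.
Proof.
have [x [x0 vx]] : exists x, x != 0 /\ (0 < v x)%E.
  case: hrank1 => x [x0 vx0]; have [vx|] := ltP 0%E (v x); first by exists x.
  rewrite le_eqVlt (negbTE vx0) /= => vx; exists x^-1; rewrite invr_eq0; split=> //.
  by rewrite -(val1 hv) -(ltr_valM hv _ _ x0) mulr1 mulfV // val1.
have := val_fin hv x0; case E : (v x) vx => [r| |] // r0 _.
have [n hn] : exists n, g < r *+ n.
  exists (Num.truncn (g / r)).+1.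
  by rewrite -mulr_natr mulrC -ltr_pdivrMr // truncnS_gt.
exists (x ^+ n); split; first exact: expf_neq0.
suff -> : v (x ^+ n) = (r *+ n)%:E by rewrite lte_fin.
elim: n {hn} => [|n IH]; first by rewrite expr0 val1.
by rewrite exprS valM // IH E mulrS EFinD.
Qed.

Lemma avoid_roots y (g : R) (qs : seq {poly K}) :
  exists w, (g%:E < v (y - w))%E /\ {in qs, forall q, q != 0 -> q.[w] != 0}.
Proof.
have [rs hrs] : exists rs : seq K, {in qs, forall q, q != 0 -> forall c, root q c -> c \in rs}.
  elim: qs => [|q qs [rs IH]]; first by exists [::].
  have [q0|q0] := eqVneq q 0.
    exists rs => p; rewrite in_cons => /orP[/eqP->|]; last exact: IH.
    by rewrite q0 eqxx.
  have [rq hrq] := roots_seq q0; exists (rq ++ rs) => p; rewrite in_cons.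
  move=> /orP[/eqP-> _ c|pqs p0 c rc]; rewrite mem_cat; first by rewrite hrq => ->.
  by rewrite (IH _ pqs p0 _ rc) orbT.
(* Within radius [g'] of [y] the only possible root is [y] itself, which a nonzero shift avoids. *)
have [g' [gg' hg']] : exists g', g <= g' /\
    {in rs, forall c, c != y -> (v (y - c) <= g'%:E)%E}.
  elim: rs {hrs} => [|c rs [g' [gg' IH]]]; first by exists g.
  have [->|cy] := eqVneq c y.
    exists g'; split=> // x; rewrite in_cons => /orP[/eqP->|]; last exact: IH.
    by rewrite eqxx.
  have: y - c != 0 by rewrite subr_eq0 eq_sym.
  move/(val_fin hv); case E : (v (y - c)) => [r| |] // _.
  exists (Num.max g' r); split; first by rewrite le_max gg'.
  move=> x; rewrite in_cons => /orP[/eqP-> _|xrs xy].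
    by rewrite E lee_fin le_max lexx orbT.
  by apply: le_trans (IH _ xrs xy) _; rewrite lee_fin le_max lexx.
have [d [d0 hd]] := val_unbounded g'.
exists (y - d); rewrite opprB addrC subrK; split.
  by apply: le_lt_trans hd; rewrite lee_fin.
move=> q hq q0; apply/negP => /(hrs _ hq q0) /hg'.
rewrite -subr_eq0 addrAC subrr add0r oppr_eq0 => /(_ d0).
by rewrite opprB addrC subrK leNgt hd.
Qed.

End Topology.

(** * Transfer to a nearby point *)

Section LocalTransfer.
Variables (K : fieldType) (R : realType) (v : K -> \bar R).
Hypotheses (hv : is_valuation v) (hrank1 : nontrivial_valuation v).
Hypotheses (hhens : henselian v) (hnat : forall n, v n.+1%:R = 0%E).

Definition same_zeros (cs : seq (termFun K)) (e e' : nat -> K) : Prop :=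
  {in cs, forall c : termFun K, (c e == 0) = (c e' == 0)}.

(* An extra parameter w, chosen close to y but generic, forces the transferred
   point y' to stay close to y: include Y - w among the polynomials. Genericity
   of w turns rv-conditions at (e, w) into conditions open in e on the stratum
   given by the vanishing of the coefficients. *)
Lemma rveq_transfer_near (ps : seq {poly termFun K}) : exists cs, forall e y g,
  exists d, forall e', near v e d e' -> same_zeros cs e e' ->
  exists y', (g%:E < v (y' - y))%E /\
    {in ps, forall p, rveq v (map_poly (tf_eval e) p).[y] (map_poly (tf_eval e') p).[y']}.
Proof.
(* The coefficient ring is enlarged by one indeterminate, specialised to [w] at both
   environments. *)
pose ev e w : {rmorphism {poly termFun K} -> K} := horner_eval w \o map_poly (tf_eval e).
have evE e w (p : {poly termFun K}) : map_poly (ev e w) (map_poly polyC p) = map_poly (tf_eval e) p.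
  rewrite -map_poly_comp; apply: eq_map_poly => c.
  by rewrite /= /horner_eval map_polyC hornerC.
have [qs hqs] := rveq_transfer hv hhens hnat
  (('X - 'X%:P) :: map (map_poly polyC) ps : seq {poly {poly termFun K}}).
exists (flatten [seq polyseq q | q <- (qs : seq {poly termFun K})]) => e y g.
have [w [yw hw]] := avoid_roots hv hrank1 y g [seq map_poly (tf_eval e) q | q <- qs].
have [|d hd] := @near_all _ _ v _ qs e (fun q e' =>
  same_zeros q e e' -> rveq v (ev e w q) (ev e' w q)).
  (* If [q] is nonzero at [e], genericity of [w] gives a nonzero value with locally constant
     rv-class. Otherwise all its coefficients vanish at [e], hence at [e']. *)
  move=> q hq; have [q0|q0] := eqVneq (map_poly (tf_eval e) q) 0; last first.
    have [] := @cont_at_rveq _ _ v hv e (fun x => (map_poly (tf_eval x) q).[w]).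
    - exact: cont_at_horner.
    - by apply: hw q0; apply: map_f.
    by move=> d hd; exists d => e' /hd.
  exists 0 => e' _ hz; left; rewrite /= /horner_eval q0.
  suff -> : map_poly (tf_eval e') q = 0 by [].
  apply/polyP => i; rewrite coef_map coef0 /=; apply/eqP.
  have [iq|qi] := ltnP i (size q); last by rewrite nth_default // rmorph0.
  rewrite -(hz _ (mem_nth 0 iq)).
  by have := congr1 (fun p : {poly K} => p`_i) q0; rewrite coef_map coef0 => /eqP.
exists d => e' /hd he' hz.
have [|y' hy'] := hqs (ev e w) (ev e' w) _ y.
  by move=> q hq; apply: he' => // c cq; apply: hz; apply/flatten_mapP; exists q.
exists y'; split; last first.
  move=> p hp; rewrite -(evE e w) -(evE e' w); apply: hy'.
  by rewrite in_cons map_f ?orbT.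
(* The polynomial Y - w gives [y' - w] the valuation of [y - w], which exceeds [g]. *)
have := hy' _ (mem_head _ _); rewrite !rmorphB /= !map_polyX !map_polyC /= /horner_eval.
rewrite !map_polyX !hornerE => /(rveq_val hv) E.
rewrite -(subrKA w); apply: valD_gt; rewrite // -?E //.
by rewrite valB.
Qed.

End LocalTransfer.

(** * Closure properties of definable sets *)

Section DefinableSets.
Variables (K k : fieldType) (R : realType) (L : augmentation).
Variables (v : K -> \bar R) (ac : K -> k) (I : aug_interp L R k) (n : nat).
Implicit Types P Q : ('I_n -> K) -> Prop.

Lemma definable_ext P Q : (forall x, P x <-> Q x) ->
  definable v ac I P -> definable v ac I Q.
Proof. by move=> PQ [phi h]; exists phi => x; rewrite -PQ. Qed.

Lemma definable_and P Q : definable v ac I P -> definable v ac I Q ->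
  definable v ac I (fun x => P x /\ Q x).
Proof. by move=> [p hp] [q hq]; exists (FAnd p q) => x /=; rewrite hp hq. Qed.

Lemma definable_not P : definable v ac I P -> definable v ac I (fun x => ~ P x).
Proof. by move=> [p hp]; exists (FNot p) => x /=; rewrite hp. Qed.

Lemma definable_eq0 (c : termFun K) : definable v ac I (fun x : 'I_n -> K => c (envK x) = 0).
Proof.
by have [t ht] := term_funP c; exists (FKeq _ _ t (KZero K)) => x /=; rewrite ht.
Qed.

Lemma definable_forall (T : finType) (P : T -> ('I_n -> K) -> Prop) :
  (forall j, definable v ac I (P j)) -> definable v ac I (fun x => forall j, P j x).
Proof.
move=> hP; suff: definable v ac I (fun x => {in enum T, forall j, P j x}).
  apply: definable_ext => x; split=> h j //; first by apply: h; rewrite mem_enum.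
elim: (enum T) => [|j s IH].
  by exists (FKeq _ _ (KZero K) (KZero K)).
apply: definable_ext (definable_and (hP j) IH) => x; split=> [[hj hs] i|h].
  by rewrite in_cons => /orP[/eqP->|/hs].
by split=> [|i hi]; apply: h; rewrite in_cons ?eqxx // hi orbT.
Qed.

End DefinableSets.

(** * Environments for points of the graph *)

Section Environments.
Variable K : fieldType.

Lemma envK_ord m (x : 'I_m -> K) (i : 'I_m) : envK x i = x i.
Proof.
rewrite /envK; case: ltnP => [h|]; last by rewrite leqNgt ltn_ord.
by congr x; apply: val_inj.
Qed.

Lemma envK_ge m (x : 'I_m -> K) i : (m <= i)%N -> envK x i = 0.
Proof. by rewrite /envK; case: ltnP => // h; rewrite leqNgt h. Qed.

Definition extend n (x : 'I_n -> K) (a b : K) : nat -> K :=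
  upd (upd (envK x) n a) n.+1 b.

Lemma extendC n (x : 'I_n -> K) a b :
  extend x a b = upd (upd (envK x) n.+1 b) n a.
Proof.
apply: funext => i; rewrite /extend /upd.
by case: eqP => // ->; rewrite gtn_eqF.
Qed.

Lemma envK_extend n (x : 'I_n -> K) a b :
  envK (fun i : 'I_n.+2 => extend x a b i) = extend x a b.
Proof.
apply: funext => i; have [hi|hi] := ltnP i n.+2.
  by rewrite -[i]/(nat_of_ord (Ordinal hi)) envK_ord.
rewrite envK_ge // /extend /upd !gtn_eqF ?envK_ge // ?(ltnW hi) //.
by apply: leq_trans hi; rewrite -addn2 leq_addr.
Qed.

Lemma extend_inord n (x : 'I_n -> K) a b (i : 'I_n) :
  extend x a b (inord i : 'I_n.+2) = x i.
Proof.
have hi := ltn_ord i; rewrite inordK; last by rewrite !ltnS ltnW // ltnW.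
by rewrite /extend /upd !ltn_eqF ?envK_ord // ltnS ltnW.
Qed.

(** For an affine chart of the projective line: one homogeneous coordinate is the indeterminate, the
    other is fixed at [c]. *)
Lemma term_fun_poly2 i j c (f : termFun K) : exists p : {poly termFun K},
  forall e y, (map_poly (tf_eval e) p).[y] = f (upd (upd e i y) j c).
Proof.
have [p hp] := term_fun_poly j f.
have [q hq] := term_fun_poly i (p.[term_fun (KConst c)] : termFun K).
exists q => e y; rewrite hq -hp -[LHS]/(tf_eval (upd e i y) _).
by rewrite -horner_map.
Qed.

End Environments.

(** * Balls and locally closed sets *)

Section Pieces.
Variables (K : fieldType) (R : realType) (v : K -> \bar R).
Hypothesis hv : is_valuation v.

Lemma vball_near n (x y : 'I_n -> K) g : vball v x g y -> near v (envK x) g (envK y).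
Proof.
move=> h i; have [ni|hi] := leqP n i.
  by rewrite !envK_ge // subr0 val0 // ltry.
by have := h (Ordinal hi); rewrite -!envK_ord.
Qed.

Lemma vball_refl n (x : 'I_n -> K) g : vball v x g x.
Proof. by move=> i; rewrite subrr val0 // ltry. Qed.

Lemma vball_trans n (x y z : 'I_n -> K) g : vball v x g y -> vball v y g z -> vball v x g z.
Proof. by move=> xy yz i; rewrite -(subrKA (y i)); apply: valD_gt. Qed.

(** A set relatively open in a closed one. The open set consists of the points with a ball on which
    [C] is contained in [P]; it is open because a ball is a ball around each of its points. *)
Lemma locally_closed_in_closed n (P C : ('I_n -> K) -> Prop) :
  openKn v (fun x => ~ C x) -> (forall x, P x -> C x) ->
  (forall x, P x -> exists g, forall y, vball v x g y -> C y -> P y) ->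
  locally_closed v P.
Proof.
move=> hC PC hP; pose U x := exists g, forall y, vball v x g y -> C y -> P y.
exists U, C; split=> // [x [g hg]|x]; last first.
  split=> [Px|[[g hg] Cx]]; first by split; [apply: hP|apply: PC].
  by apply: hg Cx; apply: vball_refl.
by exists g => y xy; exists g => z yz; apply: hg; apply: vball_trans yz.
Qed.

End Pieces.

(** * Stratification and piecewise continuity *)

Theorem theorem1p1
  (K k : fieldType) (R : realType) (v : K -> \bar R) (res ac : K -> k)
  (L : augmentation) (I : aug_interp L R k)
  (hv : is_valuation v) (hrank1 : nontrivial_valuation v)
  (hhens : henselian v)
  (hcharK : [pchar K] =i pred0) (hchark : [pchar k] =i pred0)
  (hres : residue_map v res) (hac : angular_component v res ac)
  (hI : aug_interp_ok v I)
  (n : nat) (A : ('I_n -> K) -> Prop) (f : ('I_n -> K) -> option K)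
  (hf : definable_fun v ac I A f) :
  exists (s : nat) (P : 'I_s -> ('I_n -> K) -> Prop),
    [/\ forall i, definable v ac I (P i),
        forall i, locally_closed v (P i),
        forall x, A x <-> exists i, P i x,
        forall i j x, P i x -> P j x -> i = j &
        forall i, continuous_on v (P i) f].
Proof.
have hnat := val_natS hv hchark hres.
case: hf => phi hphi.
pose graph e := sat v ac I e (fun=> v 0) (fun=> 0) phi.
have graphP x a b : graph (extend x a b) <->
    [/\ A x, (a != 0) || (b != 0) & f x = P1_of a b].
  rewrite /graph -envK_extend -hphi.
  have -> : (fun i : 'I_n => extend x a b (inord i : 'I_n.+2)) = x.
    by apply: funext => i; rewrite extend_inord.
  by rewrite !inordK // /extend /upd eqxx ltn_eqF // eqxx.
have [qs hqs] := sat_determined I hv hhens hchark hres hac phi.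
(* [F1] serves the chart of points (y : 1), [F2] that of points (1 : y). *)
have /choice[F1 hF1] := @term_fun_poly2 K n n.+1 1.
have /choice[F2 hF2] := @term_fun_poly2 K n.+1 n 1.
have [cs1 hcs1] := rveq_transfer_near hv hrank1 hhens hnat (map F1 qs).
have [cs2 hcs2] := rveq_transfer_near hv hrank1 hhens hnat (map F2 qs).
pose cs := cs1 ++ cs2.
(* The transferred point lies on the graph over [x'], which shows at once that [x'] is in [A] and
   what [f x'] is. *)
have local x V : A x -> openP1 v V -> V (f x) -> exists g, forall x',
    vball v x g x' -> same_zeros cs (envK x) (envK x') -> A x' /\ V (f x').
  move=> Ax [V1 V2] Vfx.
  case fx : (f x) Vfx => [y|] Vfx.
    have [g hg] := V1 y Vfx; have [d hd] := hcs1 (envK x) y g.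
    exists d => x' /(vball_near hv)/hd h hz; have [c hc|y' [yy' hy']] := h.
      by apply: hz; rewrite mem_cat hc.
    have : graph (extend x y 1).
      by apply/graphP; split; rewrite ?oner_eq0 ?orbT // fx /P1_of oner_eq0 divr1.
    have hag : agree v qs (tf_eval (extend x y 1)) (tf_eval (extend x' y' 1)).
      by move=> q hq; have := hy' _ (map_f F1 hq); rewrite !hF1.
    move/(hqs _ _ hag (fun=> v 0) (fun=> 0)) => /graphP[Ax' _ ->]; split=> //.
    by rewrite /P1_of oner_eq0 divr1; apply: hg.
  (* Infinity is (1 : 0), the point 0 of the second chart. *)
  have [|g hg] := V2 0; first by rewrite eqxx.
  have [d hd] := hcs2 (envK x) 0 g.
  exists d => x' /(vball_near hv)/hd h hz; have [c hc|y' [yy' hy']] := h.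
    by apply: hz; rewrite mem_cat hc orbT.
  have : graph (extend x 1 0).
    by apply/graphP; split; rewrite ?oner_eq0 // fx /P1_of eqxx.
  have hag : agree v qs (tf_eval (extend x 1 0)) (tf_eval (extend x' 1 y')).
    by move=> q hq; have := hy' _ (map_f F2 hq); rewrite !hF2 -!extendC.
  move/(hqs _ _ hag (fun=> v 0) (fun=> 0)) => /graphP[Ax' _ ->]; split=> //.
  by rewrite /P1_of div1r; apply: hg.
have defA : definable v ac I A.
  exists (FExK n (FExK n.+1 phi)) => x /=.
  split=> [Ax|[a [b /graphP[]]] //].
  case fx : (f x) => [y|].
    by exists y, 1; apply/graphP; split; rewrite ?oner_eq0 ?orbT // fx /P1_of oner_eq0 divr1.
  by exists 1, 0; apply/graphP; split; rewrite ?oner_eq0 // fx /P1_of eqxx.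
pose l := size cs; pose c (j : 'I_l) : termFun K := nth 0 cs j.
pose piece (S : {set 'I_l}) x := A x /\ forall j, (c j (envK x) = 0) <-> (j \in S).
have same S (x y : 'I_n -> K) : piece S x -> (forall j, (c j (envK y) = 0) <-> (j \in S)) ->
    same_zeros cs (envK x) (envK y).
  move=> [_ hx] hy q /(nthP 0)[i il <-].
  have := hx (Ordinal il); have := hy (Ordinal il); rewrite /c /= => <- h.
  by apply/eqP/eqP => /h.
(* One piece, possibly empty, for each set of vanishing functions. *)
exists #|{set 'I_l}|, (fun i => piece (enum_val i)); split.
- move=> i; apply: definable_and defA _; apply: definable_forall => j.
  have [jS|jS] := boolP (j \in enum_val i).
    apply: definable_ext (definable_eq0 v ac I n (c j)) => x.
    by split=> [h|[_ h]]; [split|apply: h].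
  apply: definable_ext (definable_not (definable_eq0 v ac I n (c j))) => x.
  split=> [h|[h _] /h]; last by apply/negP.
  by split=> [/h|] //; move/negP: jS.
- move=> i; set S := enum_val i.
  have nonzero j (x : 'I_n -> K) : c j (envK x) <> 0 ->
      exists g, forall e, near v (envK x) g e -> c j e <> 0.
    move/eqP => cx; have [g hg] := cont_at_rveq hv (cont_at_term_fun hv (envK x) (c j)) cx.
    by exists g => e /hg h; apply/eqP; rewrite -(rveq_eq0 hv h).
  apply: (@locally_closed_in_closed _ _ _ hv _ _
    (fun x => forall j, j \in S -> c j (envK x) = 0)).
  + move=> x /existsNP[j /not_implyP[jS /nonzero[g hg]]].
    by exists g => y /(vball_near hv)/hg cy /(_ j jS).
  + by move=> x [_ h] j /h.
  + move=> x Px.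
    have openT : openP1 v (fun=> True) by split=> ? _; exists 0.
    (* With the whole line as target, [local] shows that [A] is relatively open in the stratum. *)
    have [g1 hg1] := local x (fun=> True) Px.1 openT Logic.I.
    have [g2 hg2] : exists g, forall y, vball v x g y -> forall j, j \notin S ->
        c j (envK y) <> 0.
      have [|g hg] := @near_all _ _ v _ (enum 'I_l) (envK x)
          (fun j e => j \notin S -> c j e <> 0); last first.
        exists g => y /(vball_near hv)/hg h j; apply: h.
        by rewrite mem_enum.
      move=> j _; have [jS|jS] := boolP (j \in S); first by exists 0.
      by have [|g hg] := nonzero j x; [move/(Px.2 j); apply/negP|exists g => e' /hg].
    exists (Num.max g1 g2) => y hy Cy.
    have hy1 : vball v x g1 y by move=> j; apply: le_lt_trans (hy j); rewrite lee_fin le_max lexx.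
    have hy2 : vball v x g2 y by move=> j; apply: le_lt_trans (hy j); rewrite lee_fin le_max lexx orbT.
    have zy j : c j (envK y) = 0 <-> j \in S.
      by split=> [cy|/Cy //]; apply: contrapT => /negP jS; apply: hg2 hy2 j jS cy.
    by split=> //; have [] := hg1 y hy1 (same _ _ _ Px zy).
- move=> x; split=> [Ax|[i []//]].
  exists (enum_rank [set j | c j (envK x) == 0]); rewrite enum_rankK; split=> // j.
  by rewrite inE; split=> /eqP.
- move=> i j x [_ hi] [_ hj]; apply: enum_val_inj; apply/setP => m.
  by apply/idP/idP => /[dup] => [/hi/hj|/hj/hi].
- move=> i x Px V oV Vfx; have [g hg] := local x V Px.1 oV Vfx.
  by exists g => y [Ay zy] /hg; case/(_ (same _ _ _ Px zy)).
Qed.
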